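(* Let $(L,Q,\mathcal{M}=Z+\mathcal{D})$ be a nonholonomic mechanical system with affine constraints, with constraint manifold $M\subset TQ$ and reaction-annihilator distribution $\mathcal{R}^\circ$, and let $Y$ be a vector field on $Q$. Any two of the following three conditions imply the third: (i) $Y\in\Gamma(\mathcal{R}^\circ)$. (ii) $Y^{TQ}(L)|_M=0$. (iii) $J_Y|_M$ is a first integral of $(L,Q,\mathcal{M})$.
   Context: All objects are smooth and all vector fields are complete. $Q$ is an $n$-dimensional manifold. The Lagrangian $L:TQ\to\mathbb{R}$ has the form $L=T+b-V\circ\pi$, with $T$ the kinetic energy of a Riemannian metric on $Q$, $b$ a 1-form on $Q$ regarded as a function on $TQ$, $V$ a function on $Q$, and $\pi:TQ\to Q$ the projection. In bundle coordinates $(q,\dot q)$, $L(q,\dot q)=\frac12\dot q\cdot A(q)\dot q+b(q)\cdot\dot q-V(q)$ with $A$ symmetric and positive definite. $\mathcal{D}$ is a nonintegrable distribution on $Q$ of constant rank $r$, $1<r<n$, and $Z$ is a vector field on $Q$. The affine constraint distribution $\mathcal{M}=Z+\mathcal{D}$ has fibers $\mathcal{M}_q=Z(q)+\mathcal{D}_q\subset T_qQ$; the submanifold $M\subset TQ$ with fibers $\mathcal{M}_q$ is the constraint manifold. The constraint is ideal (d'Alembert): the equations of motion are the restriction to $M$ of $\frac{d}{dt}\frac{\partial L}{\partial\dot q}-\frac{\partial L}{\partial q}=R$, where $R:M\to\mathcal{D}^\circ$, $R(v_q)\in\mathcal{D}_q^\circ$ (annihilator of $\mathcal{D}_q$), is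 the unique such function (the reaction force) for which these equations define a dynamics on $M$. In coordinates, if $\mathcal{D}_q=\ker S(q)$ with $S(q)$ a $k\times n$ matrix of rank $k=n-r$, and $s=-SZ$, then $R=S^T(SA^{-1}S^T)^{-1}(SA^{-1}\ell-\sigma)$ with $\ell_i=\sum_j\frac{\partial^2L}{\partial\dot q_i\partial q_j}\dot q_j-\frac{\partial L}{\partial q_i}$ and $\sigma_a=\sum_{i,j}\frac{\partial S_{ai}}{\partial q_j}\dot q_i\dot q_j+\sum_j\frac{\partial s_a}{\partial q_j}\dot q_j$. A first integral of $(L,Q,\mathcal{M})$ is a function on $M$ constant along all solutions of the equations of motion. The reaction-annihilator distribution $\mathcal{R}^\circ$ has fiber $\mathcal{R}^\circ_q$ equal to the annihilator in $T_qQ$ of $\mathcal{R}_q=\bigcup_{v_q\in\mathcal{M}_q}R(v_q)\subset\mathcal{D}_q^\circ$. Thus $Y\in\Gamma(\mathcal{R}^\circ)$ (i.e. $Y$ is a section of $\mathcal{R}^\circ$) iff $\langle R(v_q),Y(q)\rangle=0$ for all $q\in Q$, $v_q\in\mathcal{M}_q$. $p$ is the momentum 1-form generated by $L$ (in coordinates $p=\partial L/\partial\dot q$), and $J_Y:=\langle p,Y\rangle:TQ\to\mathbb{R}$. The tangent lift of $Y$ is the vector field on $TQ$ given by $Y^{TQ}=\sum_iY_i\partial_{q_i}+\sum_{i,j}\dot q_j\frac{\partial Y_i}{\partial q_j}\partial_{\dot q_i}$. *)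

(* Defs.v *)
From HB Require Import structures.
From mathcomp Require Import all_boot all_order all_algebra.
From mathcomp Require Import all_classical all_reals all_analysis.

Set Implicit Arguments.
Unset Strict Implicit.
Unset Printing Implicit Defensive.
Import Order.TTheory GRing.Theory Num.Theory.
Import numFieldNormedType.Exports.

Local Open Scope classical_set_scope.
Local Open Scope ring_scope.

(** * Smooth maps between (finite-dimensional) normed spaces *)

(* [U] is always open below, so the values of [f] outside [U] are irrelevant. *)
Fixpoint Ck (R : realType) (V W : normedModType R) (k : nat) (U : set V)
    (f : V -> W) : Prop :=
  if k is k'.+1 then
    (forall x, U x -> differentiable f x) /\
    (forall v, Ck k' U (fun x => 'D_v f x))
  else forall x, U x -> {for x, continuous f}.

Definition smooth_on (R : realType) (V W : normedModType R) (U : set V)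
    (f : V -> W) : Prop := forall k, Ck k U f.

Definition basis_vec (R : realType) (n : nat) (k : 'I_n) : 'cV[R]_n :=
  delta_mx k ord0.

(** * Smooth manifolds *)

(* As usual for partial maps, [chart i] is meaningful on [chart_dom i] only and
   [chart_inv i] on its image only. [chart_at q] singles out one chart around
   each point; it serves to represent tangent vectors, see [tangent]. *)
Record manifold (R : realType) (n : nat) := Manifold {
  carrier :> topologicalType;
  chart_index : Type;
  chart_dom : chart_index -> set carrier;
  chart : chart_index -> carrier -> 'cV[R]_n;
  chart_inv : chart_index -> 'cV[R]_n -> carrier;
  chart_at : carrier -> chart_index;
  manifold_hausdorff : hausdorff_space carrier;
  manifold_second_countable : @second_countable carrier;
  chart_at_dom : forall q, chart_dom (chart_at q) q;
  chart_dom_open : forall i, open (chart_dom i);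
  chart_img_open : forall i, open (chart i @` chart_dom i);
  chartK : forall i q, chart_dom i q -> chart_inv i (chart i q) = q;
  chart_continuous : forall i q, chart_dom i q -> {for q, continuous (chart i)};
  chart_inv_continuous : forall i x, (chart i @` chart_dom i) x ->
    {for x, continuous (chart_inv i)};
  chart_transition : forall i j,
    smooth_on (chart i @` (chart_dom i `&` chart_dom j))
              (chart j \o chart_inv i) }.

Section Manifold.
Context (R : realType) (n : nat) (Q : manifold R n).
Implicit Types (i : chart_index Q) (q : Q).

Definition chart_img i : set 'cV[R]_n := chart i @` chart_dom i.

(* A tangent vector at [q] is given by its components in [chart_at q], and so is
   a covector, which acts on tangent vectors by the product row * column. *)
Definition tangent q : Type := 'cV[R]_n.
Definition cotangent q : Type := 'rV[R]_n.

Definition pairing q (a : cotangent q) (v : tangent q) : R :=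
  ((a : 'rV[R]_n) *m (v : 'cV[R]_n)) ord0 ord0.

Definition tangent_coord i q (v : tangent q) : 'cV[R]_n :=
  'd (chart i \o chart_inv (chart_at q)) (chart (chart_at q) q) v.

Definition tangent_of_coord i q (u : 'cV[R]_n) : tangent q :=
  'd (chart (chart_at q) \o chart_inv i) (chart i q) u.

Definition cotangent_coord i q (a : cotangent q) : 'rV[R]_n :=
  \row_k pairing a (tangent_of_coord i q (basis_vec R k)).

Definition smooth_fun (f : Q -> R) : Prop :=
  forall i, smooth_on (chart_img i) (f \o chart_inv i : _ -> R^o).

(** Vector fields and 1-forms *)

Definition vfield_coord i (Y : forall q, tangent q) (x : 'cV[R]_n) : 'cV[R]_n :=
  tangent_coord i (Y (chart_inv i x)).

Definition smooth_vfield (Y : forall q, tangent q) : Prop :=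
  forall i, smooth_on (chart_img i) (vfield_coord i Y).

Definition smooth_form (b : forall q, cotangent q) : Prop :=
  forall i, smooth_on (chart_img i)
    (fun x => cotangent_coord i (b (chart_inv i x))).

(** Bilinear forms on the tangent spaces, given by their matrices in [chart_at] *)

Definition gram_coord (G : Q -> 'M[R]_n) i (x : 'cV[R]_n) : 'M[R]_n :=
  let q := chart_inv i x in
  let e l : 'cV[R]_n := tangent_of_coord i q (basis_vec R l) in
  \matrix_(j, k) ((e j)^T *m G q *m e k) ord0 ord0.

(** Maps from a normed space to the manifold; curves *)

Definition smooth_map_on (V : normedModType R) (U : set V) (f : V -> Q) : Prop :=
  (forall w, U w -> {for w, continuous f}) /\
  (forall i, smooth_on (U `&` f @^-1` chart_dom i) (chart i \o f)).

Definition tangent_map (V : normedModType R) (f : V -> Q) (w u : V) :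
    tangent (f w) := 'd (chart (chart_at (f w)) \o f) w u.

Definition velocity (c : R^o -> Q) (t : R) : tangent (c t) :=
  tangent_map c t (1 : R^o).

Definition complete_vfield (Y : forall q, tangent q) : Prop :=
  forall q, exists c : R^o -> Q,
    [/\ smooth_map_on setT c, c 0 = q & forall t, velocity c t = Y (c t)].

(** Functions on the tangent bundle *)

Definition tbundle_coord i (F : forall q, tangent q -> R)
    (xu : 'cV[R]_n * 'cV[R]_n) : R^o :=
  F (chart_inv i xu.1) (tangent_of_coord i (chart_inv i xu.1) xu.2).

(* The derivative Y^TQ(F) of F along the tangent lift
   Y^TQ = sum_i Y_i d/dq_i + sum_ij q'_j (dY_i/dq_j) d/dq'_i.
   The value does not depend on the chart used around [q]. *)
Definition tangent_lift_derive (Y : forall q, tangent q)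
    (F : forall q, tangent q -> R) q (v : tangent q) : R :=
  let i := chart_at q in
  let x := chart i q in
  let u := tangent_coord i v in
  'D_(vfield_coord i Y x, 'D_u (vfield_coord i Y) x) (tbundle_coord i F) (x, u).

(* The fibre derivative: in coordinates <p, w> = sum_k (dF/dq'_k) w_k. *)
Definition fibre_derive (F : forall q, tangent q -> R) q (v w : tangent q) : R :=
  'D_(w : 'cV[R]_n) (F q : 'cV[R]_n -> R^o) (v : 'cV[R]_n).

(** Distributions *)

Definition smooth_distribution (r : nat)
    (D : forall q, {vspace 'cV[R]_n}) : Prop :=
  (forall q, \dim (D q) = r) /\
  (forall q, exists i (U : set 'cV[R]_n) (B : 'I_r -> 'cV[R]_n -> 'cV[R]_n),
    [/\ chart_dom i q, open U, U (chart i q), U `<=` chart_img i &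
      (forall a, smooth_on U (B a)) /\
      (forall x, U x -> D (chart_inv i x) =
         <<[seq (tangent_of_coord i (chart_inv i x) (B a x) : 'cV[R]_n)
           | a : 'I_r]>>%VS)]).

(* Through every point there is an integral manifold, here given by a local
   parametrisation; it is an immersion when the fibres of [D] have
   dimension [r]. *)
Definition integrable_distribution (r : nat)
    (D : forall q, {vspace 'cV[R]_n}) : Prop :=
  forall q, exists (W : set 'cV[R]_r) (f : 'cV[R]_r -> Q),
    [/\ open W, W 0, f 0 = q, smooth_map_on W f &
      forall w, W w -> forall v : 'cV[R]_n,
        v \in D (f w) <-> exists u, v = tangent_map f w u].

End Manifold.

Arguments tangent {R n Q} q.
Arguments cotangent {R n Q} q.

(** * Nonholonomic mechanical systems with affine constraints *)

(* [metric q] is the Gram matrix in [chart_at q]; the Lagrangian is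
   L = T + b - V with b = [one_form] and V = [potential]. The affine constraint
   distribution is Z + D; see [constraint]. *)
Record nonholonomic_system (R : realType) (n r : nat) (Q : manifold R n) :=
    NonholonomicSystem {
  metric : Q -> 'M[R]_n;
  one_form : forall q : Q, cotangent q;
  potential : Q -> R;
  drift : forall q : Q, tangent q;
  distribution : forall q : Q, {vspace 'cV[R]_n};
  metric_sym : forall q, (metric q)^T = metric q;
  metric_pos : forall q (v : 'cV[R]_n), v != 0 ->
    0 < (v^T *m metric q *m v) ord0 ord0;
  metric_smooth : forall i, smooth_on (chart_img i) (gram_coord metric i);
  one_form_smooth : smooth_form one_form;
  potential_smooth : smooth_fun potential;
  drift_smooth : smooth_vfield drift;
  drift_complete : complete_vfield drift;
  rank_gt1 : (1 < r)%N;
  rank_ltn : (r < n)%N;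
  distribution_smooth : smooth_distribution r distribution;
  distribution_nonintegrable : ~ integrable_distribution r distribution }.

Section Mechanics.
Context (R : realType) (n r : nat) (Q : manifold R n).
Context (sys : nonholonomic_system r Q).
Implicit Types (i : chart_index Q) (q : Q).

Definition kinetic q (v : tangent q) : R :=
  2^-1 * ((v : 'cV[R]_n)^T *m metric sys q *m (v : 'cV[R]_n)) ord0 ord0.

Definition lagrangian q (v : tangent q) : R :=
  kinetic v + pairing (one_form sys q) v - potential sys q.

Definition constraint q (v : tangent q) : Prop :=
  ((v : 'cV[R]_n) - (drift sys q : 'cV[R]_n)) \in distribution sys q.

Definition distribution_ann q : set (cotangent q) :=
  [set a | forall v : tangent q, (v : 'cV[R]_n) \in distribution sys q ->
     pairing a v = 0].

(** The Lagrangian in bundle coordinates *)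

Local Notation Lc i := (tbundle_coord i lagrangian).
Local Notation e := (basis_vec R).
Local Notation dq k := ((e k, 0) : 'cV[R]_n * 'cV[R]_n).
Local Notation dv k := ((0, e k) : 'cV[R]_n * 'cV[R]_n).

Definition ell_coord i (x u : 'cV[R]_n) : 'cV[R]_n :=
  \col_k (\sum_j 'D_(dv k) (fun y => 'D_(dq j) (Lc i) y) (x, u) * u j ord0
          - 'D_(dq k) (Lc i) (x, u)).

Definition constraint_matrix i (U : set 'cV[R]_n)
    (S : 'cV[R]_n -> 'M[R]_(n - r, n)) : Prop :=
  smooth_on U S /\
  forall x, U x -> \rank (S x) = (n - r)%N /\
    forall u : 'cV[R]_n, S x *m u = 0 <->
      (tangent_of_coord i (chart_inv i x) u : 'cV[R]_n)
        \in distribution sys (chart_inv i x).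

Definition sigma_coord i (S : 'cV[R]_n -> 'M[R]_(n - r, n))
    (x u : 'cV[R]_n) : 'cV[R]_(n - r) :=
  let s y : 'cV[R]_(n - r) := - (S y *m vfield_coord i (drift sys) y) in
  \col_a (\sum_k \sum_j 'D_(e j) (fun y => S y a k : R^o) x
                          * u k ord0 * u j ord0
          + \sum_j 'D_(e j) (fun y => s y a ord0 : R^o) x * u j ord0).

Definition reaction_coord i (S : 'cV[R]_n -> 'M[R]_(n - r, n))
    (x u : 'cV[R]_n) : 'cV[R]_n :=
  let A := gram_coord (metric sys) i x in
  (S x)^T *m invmx (S x *m invmx A *m (S x)^T)
    *m (S x *m invmx A *m ell_coord i x u - sigma_coord i S x u).

(* R = S^T (S A^-1 S^T)^-1 (S A^-1 ell - sigma) for every local matrix S with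
   kernel D. Only the values on constraint vectors matter; there they are
   determined, since such matrices exist around every point. *)
Definition is_reaction_force (F : forall q, tangent q -> cotangent q) : Prop :=
  forall q (v : tangent q), constraint v ->
    distribution_ann (F q v) /\
    forall i (U : set 'cV[R]_n) S, chart_dom i q ->
      open U -> U (chart i q) -> U `<=` chart_img i -> constraint_matrix i U S ->
      (cotangent_coord i (F q v))^T
      = reaction_coord i S (chart i q) (tangent_coord i v).

(** Dynamics. [F] stands for the reaction force. *)

Definition is_solution (F : forall q, tangent q -> cotangent q)
    (I : set R^o) (c : R^o -> Q) : Prop :=
  [/\ open I, is_interval I, smooth_map_on I c,
      forall t, I t -> constraint (velocity c t) &
      forall t i k, I t -> chart_dom i (c t) ->
        let x (tau : R^o) : 'cV[R]_n := chart i (c tau) in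
        derive1 (fun tau : R^o => 'D_(dv k) (Lc i) (x tau, derive1 x tau)) t
          - 'D_(dq k) (Lc i) (x t, derive1 x t)
        = cotangent_coord i (F (c t) (velocity c t)) ord0 k].

(* Completeness of the vector field on the constraint manifold which the
   equations of motion define. *)
Definition complete_dynamics (F : forall q, tangent q -> cotangent q) : Prop :=
  forall q (v : tangent q), constraint v ->
    exists c : R^o -> Q,
      [/\ is_solution F setT c, c 0 = q & velocity c 0 = v :> 'cV[R]_n].

Definition first_integral (F : forall q, tangent q -> cotangent q)
    (f : forall q, tangent q -> R) : Prop :=
  forall I c, is_solution F I c -> forall t1 t2, I t1 -> I t2 ->
    f (c t1) (velocity c t1) = f (c t2) (velocity c t2).

Definition reaction_set (F : forall q, tangent q -> cotangent q) q :
    set (cotangent q) :=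
  [set F q v | v in [set v : tangent q | constraint v]].

Definition reaction_annihilator (F : forall q, tangent q -> cotangent q) q :
    set (tangent q) :=
  [set w | forall a, reaction_set F a -> pairing a w = 0].

(* J_Y = <p, Y> *)
Definition momentum (Y : forall q : Q, tangent q) q (v : tangent q) : R :=
  fibre_derive lagrangian v (Y q).

End Mechanics.

Arguments reaction_set {R n r Q} sys F q.
Arguments reaction_annihilator {R n r Q} sys F q.

(* Main.v *)
Require Import Defs.
From HB Require Import structures.
From mathcomp Require Import all_boot all_order all_algebra.
From mathcomp Require Import all_classical all_reals all_analysis.
From mathcomp Require Import ring.

(** Along every solution [c] of the equations of motion the momentum obeys the
    balance law

      d/dt J_Y(c') = Y^TQ(L)(c') + <R(c'), Y(c)>.

    In bundle coordinates J_Y is the sum over k of p_k Y_k, where p_k is the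
    derivative of L in the k-th velocity. The product rule gives
    p_k' Y_k + p_k Y_k', the equations of motion turn p_k' into dL/dq_k + R_k,
    and Y_k' is the derivative of Y_k in the direction of the velocity: apart
    from R_k Y_k, what remains is the derivative of L along the tangent lift
    of Y ([momentum_balance]).

    If the right-hand side vanishes on all constraint vectors, then J_Y is
    constant along each solution by the mean value theorem, because solutions
    live on intervals ([first_integral_of_balance]). Conversely, every
    constraint vector is the velocity of some solution, since the dynamics is
    complete, so a first integral J_Y forces the right-hand side to vanish on
    all of them ([balance_of_first_integral]). Thus [cond_iii] says that the two
    terms on the right add up to zero on the constraint manifold, [cond_ii] says
    that the first one is zero there and [cond_i] that the second one is; any
    two of these statements imply the third.

    Two points need care. The fibres of the tangent bundle are represented in a
    preferred chart which changes with the base point, so before J_Y can be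
    differentiated in time it has to be expressed in one fixed chart
    ([velocity_coord], [momentum_coordE]). And the derivative of p_k in the
    equations of motion is meaningful only because p_k is differentiable along
    the curve; this follows from the explicit formula for the momenta of a
    Lagrangian quadratic in the velocities ([lagrangian_fibre_derive],
    [momentum_coord_differentiable]). *)

Set Implicit Arguments.
Unset Strict Implicit.
Unset Printing Implicit Defensive.
Import Order.TTheory GRing.Theory Num.Theory.
Import numFieldNormedType.Exports.

Local Open Scope classical_set_scope.
Local Open Scope ring_scope.

(** * Differential calculus *)

(** The differential depends on the germ only; the changes of chart below agree
    with each other merely near a point. *)
Lemma near_eq_diff (R : realType) (V W : normedModType R) (f g : V -> W) (x : V) :
  (\near x, f x = g x) -> differentiable f x ->
  differentiable g x /\ 'd g x = 'd f x :> (V -> W).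
Proof.
move=> fg df.
have fgx : f x = g x := nbhs_singleton fg.
have gE : g \o shift x = cst (g x) + 'd f x +o_ 0 id.
  apply/eqaddoP => e e0.
  have /diff_locally/eqaddoP/(_ e e0) := df.
  have : \forall h \near (0 : V), f (h + x) = g (h + x).
    by have := fg; rewrite (near_shift 0) /= subr0.
  apply: filterS2 => h fgh; rewrite /cst/=.
  by rewrite !fctE /= fgh fgx.
have dg : 'd g x = 'd f x :> (V -> W).
  by apply: diff_unique => //; exact: diff_continuous.
split=> //; apply/diff_locallyP; split; last by rewrite dg.
by rewrite dg; exact: diff_continuous.
Qed.

Lemma diff_comp_apply (R : realType) (U V W : normedModType R) (f : U -> V)
    (g : V -> W) (x v : U) : differentiable f x -> differentiable g (f x) ->
  'd (g \o f) x v = 'd g (f x) ('d f x v).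
Proof. by move=> df dg; rewrite (diff_comp df dg). Qed.

Lemma smooth_on_differentiable (R : realType) (V W : normedModType R)
    (U : set V) (f : V -> W) (x : V) :
  smooth_on U f -> U x -> differentiable f x.
Proof. by move=> /(_ 1%N)[+ _] => /[apply]. Qed.

(** The difference quotient is [p + h * k], which tends to [p]. This serves on the
    fibres of the tangent bundle, where the Lagrangian is quadratic. *)
Lemma derive_quadratic (R : realType) (V : normedModType R) (f : V -> R^o)
    (a v : V) (p k : R) :
  (forall h : R, f (h *: v + a) = f a + h * p + h ^+ 2 * k) -> 'D_v f a = p.
Proof.
move=> fE; apply: cvg_lim => //.
have near_quotient : {near 0^', (fun h : R => (p + h * k : R^o)) =1
    (fun h => h^-1 *: ((f \o shift a) (h *: v) - f a))}.
  near=> h; rewrite /= fE.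
  have h0 : h != 0 by near: h; exact: nbhs_dnbhs_neq.
  by rewrite /GRing.scale /=; field.
apply: cvg_trans (near_eq_cvg near_quotient) _.
apply: cvg_within_filter.
have : {for (0 : R), continuous (fun h : R => p + h * k : R^o)}.
  apply: cvgD; first exact: cvg_cst.
  by apply: cvgM; [exact: cvg_id|exact: cvg_cst].
by rewrite /prop_for /continuous_at mul0r addr0.
Unshelve. all: by end_near. Qed.

(** A directional derivative only involves the values on one line, so the two
    functions may live on different spaces: here a fibre of the tangent bundle
    and the space of bundle coordinates. *)
Lemma eq_derive_line (R : realType) (V W : normedModType R) (f : V -> R^o)
    (g : W -> R^o) (a v : V) (b w : W) :
  (forall h : R, f (h *: v + a) = g (h *: w + b)) -> 'D_v f a = 'D_w g b.
Proof.
move=> fg; have fagb : f a = g b by have := fg 0; rewrite !scale0r !add0r.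
rewrite /derive fagb.
have -> // : (fun h : R => h^-1 *: ((f \o shift a) (h *: v) - g b)) =
    (fun h : R => h^-1 *: ((g \o shift b) (h *: w) - g b)).
by apply/funext => h; rewrite /= fg.
Qed.

Lemma differentiable_entry (R : realType) (V : normedModType R) (m n : nat)
    (f : V -> 'M[R]_(m, n)) (x : V) j k :
  differentiable f x -> differentiable (fun y => f y j k : R^o) x.
Proof. by move=> df; exact: (differentiable_comp df (differentiable_coord _ _ _)). Qed.

Lemma differentiable_mulmx_entry (R : realType) (V : normedModType R)
    (m n p : nat) (f : V -> 'M[R]_(m, n)) (g : V -> 'M[R]_(n, p)) (x : V) j k :
  differentiable f x -> differentiable g x ->
  differentiable (fun y => (f y *m g y) j k : R^o) x.
Proof.
move=> df dg.
have -> : (fun y => (f y *m g y) j k : R^o) =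
    \sum_(l < n) (fun y => f y j l * g y l k : R^o).
  by apply/funext => y; rewrite fct_sumE mxE.
apply: differentiable_sum => l.
by apply: differentiableM; exact: differentiable_entry.
Qed.

Lemma differentiable_fst (R : realType) (V W : normedModType R) (z : V * W) :
  differentiable (fst : V * W -> V) z.
Proof. by apply: linear_differentiable => ?; exact: cvg_fst. Qed.

Lemma differentiable_snd (R : realType) (V W : normedModType R) (z : V * W) :
  differentiable (snd : V * W -> W) z.
Proof. by apply: linear_differentiable => ?; exact: cvg_snd. Qed.

Lemma derive_cV_pair (R : realType) (n : nat)
    (f : 'cV[R]_n * 'cV[R]_n -> R^o) z (a w : 'cV[R]_n) :
  differentiable f z ->
  'D_(a, w) f z = \sum_k 'D_(basis_vec R k, 0) f z * a k ord0
                + \sum_k 'D_(0, basis_vec R k) f z * w k ord0.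
Proof.
move=> df; rewrite deriveE //.
have sumE (v : 'cV[R]_n) : v = \sum_k v k ord0 *: basis_vec R k.
  rewrite [LHS]matrix_sum_delta; apply: eq_bigr => k _.
  by rewrite big_ord1.
have -> : (a, w) = \sum_k a k ord0 *: (basis_vec R k, 0 : 'cV[R]_n)
    + \sum_k w k ord0 *: (0 : 'cV[R]_n, basis_vec R k).
  rewrite {1}(sumE a) {1}(sumE w); apply: injective_projections;
    rewrite /= ?(big_morph fst (fun _ _ => erefl) erefl)
      ?(big_morph snd (fun _ _ => erefl) erefl) /=.
  - by rewrite [X in _ + X]big1 ?addr0 // => k _; rewrite /= scaler0.
  - by rewrite [X in X + _]big1 ?add0r // => k _; rewrite /= scaler0.
rewrite linearD !linear_sum; congr (_ + _); apply: eq_bigr => k _;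
  by rewrite linearZ deriveE // mulrC.
Qed.

(** * Tangent vectors and curves in charts *)

Section Charts.
Context (R : realType) (n : nat) (Q : manifold R n).
Implicit Types (i j : chart_index Q) (q : Q).

Lemma nbhs_chart_domI i j q : chart_dom i q -> chart_dom j q ->
  nbhs (chart i q) (chart i @` (chart_dom i `&` chart_dom j)).
Proof.
move=> iq jq; have ix : (chart i @` chart_dom i) (chart i q) by exists q.
have near_j : nbhs (chart_inv i (chart i q)) (chart_dom j).
  by rewrite chartK //; exact: (open_nbhs_nbhs (conj (@chart_dom_open _ _ Q j) jq)).
have := chart_inv_continuous ix near_j.
have := open_nbhs_nbhs (conj (@chart_img_open _ _ Q i) ix).
by apply: filterS2 => _ [p ip <-]; rewrite /= chartK // => jp; exists p.
Qed.

Lemma transition_differentiable i j q : chart_dom i q -> chart_dom j q ->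
  differentiable (chart j \o chart_inv i) (chart i q).
Proof.
by move=> iq jq; apply: (smooth_on_differentiable (chart_transition i j)); exists q.
Qed.

Lemma transition_self_diff i q : chart_dom i q ->
  'd (chart i \o chart_inv i) (chart i q) = id :> ('cV[R]_n -> 'cV[R]_n).
Proof.
move=> iq; have [] := @near_eq_diff _ _ _ id (chart i \o chart_inv i) (chart i q).
- have := nbhs_chart_domI iq iq; apply: filterS => _ [p [ip _] <-].
  by rewrite /= chartK.
- exact: ex_diff.
- by move=> _ ->; exact: diff_val.
Qed.

Lemma tangent_coord_at q (v : tangent q) : tangent_coord (chart_at q) v = v.
Proof. by rewrite /tangent_coord transition_self_diff //; exact: chart_at_dom. Qed.

Lemma tangent_of_coord_at q u : tangent_of_coord (chart_at q) q u = u.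
Proof. by rewrite /tangent_of_coord transition_self_diff //; exact: chart_at_dom. Qed.

(** Near the point the two changes of chart are inverse to each other, hence so
    are their differentials. *)
Lemma tangent_of_coordK i q (v : tangent q) : chart_dom i q ->
  tangent_of_coord i q (tangent_coord i v) = v.
Proof.
move=> iq; have aq := chart_at_dom q.
rewrite /tangent_of_coord /tangent_coord.
move: (chart_at q) aq => a aq.
have dai := transition_differentiable aq iq.
have dia := transition_differentiable iq aq.
set f := chart i \o chart_inv a in dai *.
set g := chart a \o chart_inv i in dia *.
have fq : f (chart a q) = chart i q by rewrite /f /= chartK.
rewrite -fq in dia.
rewrite -fq -(diff_comp_apply v dai dia).
have [] := @near_eq_diff _ _ _ id (g \o f) (chart a q).
- have := nbhs_chart_domI aq iq; apply: filterS => _ [p [ap ip] <-].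
  by rewrite /g /f /= !chartK.
- exact: ex_diff.
- by move=> _ ->; rewrite diff_val.
Qed.

Context (I : set R^o) (c : R^o -> Q).
Hypotheses (I_open : open I) (c_smooth : smooth_map_on I c).

Lemma nbhs_curve_in_chart i t : I t -> chart_dom i (c t) ->
  nbhs t (I `&` c @^-1` chart_dom i).
Proof.
move=> It it; apply: filterI; first exact: (open_nbhs_nbhs (conj I_open It)).
apply: (c_smooth.1 t It).
exact: (open_nbhs_nbhs (conj (@chart_dom_open _ _ Q i) it)).
Qed.

Lemma curve_coord_differentiable i t : I t -> chart_dom i (c t) ->
  differentiable (chart i \o c) t.
Proof. by move=> It it; apply: (smooth_on_differentiable (c_smooth.2 i)). Qed.

Lemma curve_coord_derive1_derivable i t : I t -> chart_dom i (c t) ->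
  derivable (derive1 (chart i \o c)) t (1 : R^o).
Proof.
move=> It it; have [_ /(_ 1) [+ _]] := c_smooth.2 i 2%N.
have -> : derive1 (chart i \o c) = (fun x => 'D_1 (chart i \o c) x).
  by apply/funext => x; rewrite derive1E.
by move=> /(_ t (conj It it)) /diff_derivable; exact.
Qed.

(** The components of the velocity in a chart fixed in advance. The definition of
    [velocity] uses the chart chosen at the moving point [c t], so it cannot be
    differentiated in time directly. *)
Lemma velocity_coord i t : I t -> chart_dom i (c t) ->
  velocity c t = tangent_of_coord i (c t) (derive1 (chart i \o c) t).
Proof.
move=> It it; have at_ := chart_at_dom (c t).
rewrite /velocity /tangent_map /tangent_of_coord.
move: (chart_at (c t)) at_ => a at_.
have dc := curve_coord_differentiable It it.
have dia := transition_differentiable it at_.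
rewrite derive1E'//.
rewrite -(diff_comp_apply (1 : R^o) dc dia).
have [] := @near_eq_diff _ _ _ ((chart a \o chart_inv i) \o (chart i \o c))
  (chart a \o c) t.
- have := nbhs_curve_in_chart It it; apply: filterS => s [_ is_] /=.
  by rewrite chartK.
- exact: differentiable_comp.
- by move=> _ /(congr1 (fun h => h (1 : R^o))).
Qed.

Lemma velocity_at t : I t ->
  velocity c t = derive1 (chart (chart_at (c t)) \o c) t.
Proof.
move=> It; rewrite (velocity_coord It (chart_at_dom _)).
by rewrite tangent_of_coord_at.
Qed.

End Charts.

Section Coordinates.
Context (R : realType) (n : nat) (Q : manifold R n).
Implicit Types (i : chart_index Q) (q : Q).

(** The Jacobian matrix of the change of chart from [i] to the chart chosen at
    [q]. *)
Definition frame i q : 'M[R]_n :=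
  \matrix_(k, l) (tangent_of_coord i q (basis_vec R l) : 'cV[R]_n) k ord0.

Lemma tangent_of_coordE i q u : tangent_of_coord i q u = frame i q *m u.
Proof.
rewrite [in LHS](matrix_sum_delta u) /tangent_of_coord linear_sum /=.
apply/colP => k; rewrite summxE mxE; apply: eq_bigr => l _.
by rewrite big_ord1 linearZ mxE mulrC /frame mxE.
Qed.

Lemma cotangent_coordE i q (a : cotangent q) :
  cotangent_coord i a = (a : 'rV[R]_n) *m frame i q.
Proof.
apply/rowP => k; rewrite /cotangent_coord /pairing !mxE.
by under [RHS]eq_bigr do rewrite mxE.
Qed.

Lemma pairing_tangent_of_coord i q (a : cotangent q) u :
  pairing a (tangent_of_coord i q u) = (cotangent_coord i a *m u) ord0 ord0.
Proof. by rewrite /pairing tangent_of_coordE cotangent_coordE mulmxA. Qed.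

Lemma gram_coordE (G : Q -> 'M[R]_n) i x :
  gram_coord G i x =
  (frame i (chart_inv i x))^T *m G (chart_inv i x) *m frame i (chart_inv i x).
Proof.
apply/matrixP => j k; rewrite mxE /= !tangent_of_coordE trmx_mul /basis_vec.
rewrite trmx_delta !mulmxA -[LHS]/(((_ *m _ *m _ *m _) *m delta_mx k ord0) ord0 ord0).
by rewrite -!mulmxA -rowE [LHS]mxE !mulmxA -colE [LHS]mxE.
Qed.

End Coordinates.

(** * The Lagrangian and its momenta in bundle coordinates *)

Section Lagrangian.
Context (R : realType) (n r : nat) (Q : manifold R n).
Context (sys : nonholonomic_system r Q).
Implicit Types (i : chart_index Q) (q : Q).

Local Notation G := (metric sys).
Local Notation b := (one_form sys).
Local Notation Lc i := (tbundle_coord i (lagrangian sys)).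

Definition metric_coord i x := gram_coord G i x.
Definition one_form_coord i x := cotangent_coord i (b (chart_inv i x)).

(** The row of the momenta p_k = dL/dq'_k, see [lagrangian_fibre_derive]. *)
Definition momentum_coord i (z : 'cV[R]_n * 'cV[R]_n) : 'rV[R]_n :=
  z.2^T *m metric_coord i z.1 + one_form_coord i z.1.

Lemma tbundle_coord_lagrangianE i x u :
  Lc i (x, u) = 2^-1 * (u^T *m metric_coord i x *m u) ord0 ord0
    + (one_form_coord i x *m u) ord0 ord0 - potential sys (chart_inv i x).
Proof.
rewrite /tbundle_coord /lagrangian /kinetic /= pairing_tangent_of_coord.
by rewrite /metric_coord gram_coordE tangent_of_coordE trmx_mul !mulmxA.
Qed.

(** The Lagrangian is quadratic on each fibre; the two cross terms agree because
    the metric is symmetric. *)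
Lemma lagrangian_fibre_derive i x u w :
  'D_(0, w) (Lc i) (x, u) = (momentum_coord i (x, u) *m w) ord0 ord0.
Proof.
apply: (@derive_quadratic _ _ _ _ _ _
  (2^-1 * (w^T *m metric_coord i x *m w) ord0 ord0)) => h.
have -> : h *: (0, w) + (x, u) = (x, h *: w + u) :> 'cV[R]_n * 'cV[R]_n.
  by congr (_, _); rewrite /= ?scaler0 ?add0r.
rewrite !tbundle_coord_lagrangianE /momentum_coord /=.
have G_sym : (metric_coord i x)^T = metric_coord i x.
  by rewrite /metric_coord gram_coordE !trmx_mul trmxK Defs.metric_sym !mulmxA.
have cross : (w^T *m metric_coord i x *m u) ord0 ord0 =
    (u^T *m metric_coord i x *m w) ord0 ord0.
  rewrite -[in LHS](trmxK (_ *m u)) mxE !trmx_mul G_sym trmxK.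
  by rewrite mulmxA.
have -> : (h *: w + u)^T = h *: w^T + u^T by rewrite linearD linearZ.
rewrite !mulmxDl !mulmxDr -!scalemxAl -!scalemxAr.
have entryD (M N : 'M[R]_1) : (M + N) ord0 ord0 = M ord0 ord0 + N ord0 ord0.
  by rewrite mxE.
have entryZ (a : R) (M : 'M[R]_1) : (a *: M) ord0 ord0 = a * M ord0 ord0.
  by rewrite mxE.
by rewrite !(entryD, entryZ) cross; field.
Qed.

Lemma fibre_derive_tangent_of_coord i q u w : chart_dom i q ->
  fibre_derive (lagrangian sys) (tangent_of_coord i q u) (tangent_of_coord i q w)
  = (momentum_coord i (chart i q, u) *m w) ord0 ord0.
Proof.
move=> iq; rewrite -lagrangian_fibre_derive; apply: eq_derive_line => h.
rewrite /tbundle_coord /= scaler0 add0r chartK //.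
by rewrite !tangent_of_coordE mulmxDr -scalemxAr.
Qed.

Lemma metric_coord_differentiable i x : chart_img i x ->
  differentiable (metric_coord i) x.
Proof. exact/smooth_on_differentiable/metric_smooth. Qed.

Lemma one_form_coord_differentiable i x : chart_img i x ->
  differentiable (one_form_coord i) x.
Proof. exact/smooth_on_differentiable/one_form_smooth. Qed.

Lemma momentum_coord_differentiable i z k : chart_img i z.1 ->
  differentiable (fun z => momentum_coord i z ord0 k : R^o) z.
Proof.
move=> iz.
have dx := differentiable_fst z.
have dG := differentiable_comp dx (metric_coord_differentiable iz).
have db := differentiable_comp dx (one_form_coord_differentiable iz).
have -> : (fun z => momentum_coord i z ord0 k : R^o) =
    \sum_j (fun z : 'cV[R]_n * 'cV[R]_n => z.2 j ord0 * metric_coord i z.1 j k : R^o)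
    + (fun z : 'cV[R]_n * 'cV[R]_n => one_form_coord i z.1 ord0 k : R^o).
  apply/funext => y; rewrite [LHS]mxE !fctE fct_sumE; congr (_ + _).
  by rewrite mxE; apply: eq_bigr => j _; rewrite mxE.
apply: differentiableD; last exact: (differentiable_entry _ _ db).
apply: differentiable_sum => j; apply: differentiableM.
  exact: (differentiable_entry _ _ (differentiable_snd z)).
exact: (differentiable_entry _ _ dG).
Qed.

Lemma lagrangian_coord_differentiable i z : chart_img i z.1 ->
  differentiable (Lc i) z.
Proof.
move=> iz.
have dx := differentiable_fst z; have du := differentiable_snd z.
have dG := differentiable_comp dx (metric_coord_differentiable iz).
have db := differentiable_comp dx (one_form_coord_differentiable iz).
have dV := differentiable_comp dx
  (smooth_on_differentiable (@potential_smooth _ _ _ _ sys i) iz).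
have -> : Lc i =
    2^-1 *: \sum_j (fun z : 'cV[R]_n * 'cV[R]_n =>
      z.2 j ord0 * (metric_coord i z.1 *m z.2) j ord0 : R^o)
    + (fun z : 'cV[R]_n * 'cV[R]_n => (one_form_coord i z.1 *m z.2) ord0 ord0 : R^o)
    - (fun z : 'cV[R]_n * 'cV[R]_n => potential sys (chart_inv i z.1) : R^o).
  apply/funext => -[x u]; rewrite tbundle_coord_lagrangianE !fctE fct_sumE.
  congr (_ * _ + _ - _); rewrite -mulmxA mxE.
  by apply: eq_bigr => j _; rewrite mxE.
apply: differentiableB => //; apply: differentiableD; last first.
  exact: (differentiable_mulmx_entry _ _ db du).
apply/differentiableZ/differentiable_sum => j; apply: differentiableM.
  exact: (differentiable_entry _ _ du).
exact: (differentiable_mulmx_entry _ _ dG du).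
Qed.

End Lagrangian.

(** * The balance law for the momentum *)

Section Balance.
Context (R : realType) (n r : nat) (Q : manifold R n).
Context (sys : nonholonomic_system r Q).
Context (F : forall q : Q, tangent q -> cotangent q).
Context (Y : forall q : Q, tangent q) (Y_smooth : smooth_vfield Y).
Implicit Types (i : chart_index Q) (q : Q).

Local Notation Lc i := (tbundle_coord i (lagrangian sys)).

Lemma momentum_coordE i q u : chart_dom i q ->
  momentum sys Y (tangent_of_coord i q u) =
  (momentum_coord sys i (chart i q, u) *m vfield_coord i Y (chart i q)) ord0 ord0.
Proof.
move=> iq; rewrite /momentum -fibre_derive_tangent_of_coord //.
by rewrite /vfield_coord chartK // tangent_of_coordK.
Qed.

(** The product rule and the equations of motion, written in the chart chosen at
    [c t], the one in which the derivative along the tangent lift is defined. *)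
Lemma momentum_balance (I : set R^o) (c : R^o -> Q) t :
  is_solution sys F I c -> I t ->
  is_derive t (1 : R^o) (fun s : R^o => momentum sys Y (velocity c s) : R^o)
    (tangent_lift_derive Y (lagrangian sys) (velocity c t)
     + pairing (F (velocity c t)) (Y (c t))).
Proof.
move=> [I_open _ c_smooth _ eom] It.
have it := chart_at_dom (c t).
rewrite /tangent_lift_derive tangent_coord_at (velocity_at I_open c_smooth It).
set i := chart_at (c t) in it *.
set x := chart i \o c; set u := derive1 x; set y := vfield_coord i Y.
have ix : chart_img i (x t) by exists (c t).
have dx : differentiable x t := curve_coord_differentiable c_smooth It it.
have du : differentiable u t.
  exact/derivable1_diffP/(curve_coord_derive1_derivable c_smooth It it).
have dy : differentiable y (x t) := smooth_on_differentiable (Y_smooth i) ix.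
have dL : differentiable (Lc i) (x t, u t) by exact: lagrangian_coord_differentiable.
pose p (s : R^o) : 'rV[R]_n := momentum_coord sys i (x s, u s).
have pE k s : p s ord0 k = 'D_(0, basis_vec R k) (Lc i) (x s, u s).
  by rewrite lagrangian_fibre_derive -colE [RHS]mxE.
have dp k : derivable (fun s => p s ord0 k : R^o) t (1 : R^o).
  apply/derivable1_diffP.
  exact: (differentiable_comp (differentiable_pair dx du)
    (momentum_coord_differentiable sys (z := (x t, u t)) k ix)).
have dyx k : derivable (fun s => y (x s) k ord0 : R^o) t (1 : R^o).
  apply/derivable1_diffP.
  exact: (differentiable_entry _ _ (differentiable_comp dx dy)).
(* Only near t does the curve stay in the domain of the chart i. *)
have near_mom : \near t, (\sum_k (fun s => p s ord0 k * y (x s) k ord0 : R^o)) t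
    = momentum sys Y (velocity c t) :> R^o.
  have := nbhs_curve_in_chart I_open c_smooth It it.
  apply: filterS => s [Is is_].
  rewrite (velocity_coord I_open c_smooth Is is_) momentum_coordE //.
  by rewrite fct_sumE [RHS]mxE.
apply: (near_eq_is_derive near_mom).
have dpE k : 'D_1 (fun s => p s ord0 k : R^o) t =
    'D_(basis_vec R k, 0) (Lc i) (x t, u t)
    + cotangent_coord i (F (u t : tangent (c t))) ord0 k.
  have /eqP := eom t i k It it.
  rewrite (velocity_at I_open c_smooth It) subr_eq addrC => /eqP <-.
  by rewrite derive1E; congr ('D_1 _ t); apply/funext => s; rewrite pE.
have dyxE k : 'D_1 (fun s => y (x s) k ord0 : R^o) t = ('D_(u t) y (x t)) k ord0.
  have dyx' : differentiable (y \o x) t := differentiable_comp dx dy.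
  have -> : 'D_(u t) y (x t) = 'D_1 (y \o x) t.
    by rewrite !deriveE // diff_comp_apply // /u derive1E'.
  by rewrite derive_mx ?mxE //; exact: diff_derivable.
have dterm k := is_deriveM (derivableP (dp k)) (derivableP (dyx k)).
apply: (is_derive_eq (is_derive_sum dterm)).
rewrite derive_cV_pair //.
rewrite -[Y (c t)](tangent_of_coordK (i := i)) // pairing_tangent_of_coord.
have -> : tangent_coord i (Y (c t)) = y (x t).
  by rewrite /y /vfield_coord /x /= chartK.
rewrite mxE -!big_split /=; apply: eq_bigr => k _.
rewrite dpE dyxE -pE /GRing.scale /=.
ring.
Qed.

Lemma first_integral_of_balance :
  (forall q (v : tangent q), constraint sys v ->
    tangent_lift_derive Y (lagrangian sys) v + pairing (F v) (Y q) = 0) ->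
  first_integral sys F (momentum sys Y).
Proof.
move=> balance I c sol.
have [_ I_itv _ c_constraint _] := sol.
pose J (s : R) : R := momentum sys Y (velocity c s).
have dJ s : I s -> is_derive s 1 J 0.
  move=> Is; have := momentum_balance sol Is.
  by rewrite balance //; exact: c_constraint.
move=> t1 t2.
wlog t12 : t1 t2 / t1 <= t2.
  move=> H; have [|/ltW] := leP t1 t2; first exact: H.
  by move=> t21 I1 I2; rewrite (H t2 t1).
move=> I1 I2.
have I12 s : s \in `[t1, t2]%R -> I s.
  by rewrite in_itv /= => s12; exact: (I_itv t1 t2).
have [||s _] := @MVT_segment R J (fun=> 0) _ _ t12.
- by move=> s s12; apply/dJ/I12; exact: subset_itv_oo_cc s12.
- apply: derivable_within_continuous => s s12.
  by have [] := dJ s (I12 s s12).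
- by rewrite mul0r => /subr0_eq/esym J12; exact: J12.
Qed.

(** Completeness of the dynamics provides a solution through every constraint
    vector; the law is read off at its initial time. *)
Lemma balance_of_first_integral :
  complete_dynamics sys F -> first_integral sys F (momentum sys Y) ->
  forall q (v : tangent q), constraint sys v ->
    tangent_lift_derive Y (lagrangian sys) v + pairing (F v) (Y q) = 0.
Proof.
move=> hdyn J_cst q v v_constraint.
have [c [sol c0 cv]] := hdyn q v v_constraint.
have [_ dJ] := momentum_balance sol (I : setT 0).
move: dJ.
have -> : (fun s => momentum sys Y (velocity c s) : R^o)
    = cst (momentum sys Y (velocity c 0)).
  by apply/funext => s; exact: J_cst sol _ _ _ _.
rewrite derive_cst; move: (velocity c 0) cv => w.
case: _ / c0 in v v_constraint * => wv.
by rewrite wv.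
Qed.

End Balance.

Theorem proposition2 (R : realType) (n r : nat) (Q : manifold R n)
    (sys : nonholonomic_system r Q)
    (F : forall q : Q, tangent q -> cotangent q)
    (hF : is_reaction_force sys F)
    (hdyn : complete_dynamics sys F)
    (Y : forall q : Q, tangent q)
    (hY : smooth_vfield Y)
    (hYc : complete_vfield Y) :
  let cond_i := forall q : Q, reaction_annihilator sys F q (Y q) in
  let cond_ii := forall (q : Q) (v : tangent q), constraint sys v ->
    tangent_lift_derive Y (lagrangian sys) v = 0%R in
  let cond_iii := first_integral sys F (momentum sys Y) in
  (cond_i -> cond_ii -> cond_iii) /\
  (cond_i -> cond_iii -> cond_ii) /\
  (cond_ii -> cond_iii -> cond_i).
Proof.
move=> cond_i cond_ii cond_iii.
have workless q (v : tangent q) : cond_i -> constraint sys v ->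
    pairing (F q v) (Y q) = 0.
  by move=> Yann v_constraint; apply: Yann; exists v.
split=> [Yann LY0|]; first apply: first_integral_of_balance => // q v v_constraint.
  by rewrite LY0 // workless // addr0.
split=> [Yann|LY0] /(balance_of_first_integral hY hdyn) balance.
  by move=> q v v_constraint; rewrite -(balance q v v_constraint) workless // addr0.
move=> q _ [v v_constraint <-].
by rewrite -(balance q v v_constraint) LY0 // add0r.
Qed.
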